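(* Let $n,m,k\in\mathbb{N}$ be positive integers, $\lambda\ge 0$, $H\in\mathcal{S}^{nm}$, $D\in\mathbb{R}^{n\times m}$, and for each $i$ in an index set $\mathcal{I}$ let $Q_i\in\mathcal{S}^{nm}$, $E_i\in\mathbb{R}^{n\times m}$, $b_i\in\mathbb{R}$. Consider the problem (P1) $$\begin{aligned}\min\quad & \lambda\,\mathrm{tr}(Y)+\langle W_{x,x},H\rangle+\langle D,X\rangle\\ \text{s.t.}\quad & \begin{pmatrix}1&\mathrm{vec}(X^\top)^\top&\mathrm{vec}(Y)^\top\\ \mathrm{vec}(X^\top)&W_{x,x}&W_{x,y}\\ \mathrm{vec}(Y)&W_{x,y}^\top&W_{y,y}\end{pmatrix}\succeq 0,\\ & \sum_{i=1}^nW_{y,y}^{(i,i)}=Y,\qquad \sum_{i=1}^nW_{x,y}^{(i,i)}=X^\top,\\ & \langle Q_i,W_{x,x}\rangle+\langle E_i,X\rangle\le b_i\quad\forall i\in\mathcal{I},\end{aligned}$$ over $Y\in\mathcal{S}^n_+$ with $Y\preceq I_n$ and $\mathrm{tr}(Y)\le k$, $W_{y,y}\in\mathcal{S}^{n^2}_+$, $X\in\mathbb{R}^{n\times m}$, $W_{x,x}\in\mathcal{S}^{nm}_+$, $W_{x,y}\in\mathbb{R}^{nm\times n^2}$. Then (P1) is equivalent to (has the same optimal value as) the problem (P2) $$\begin{aligned}\min\quad & \lambda\,\mathrm{tr}(Y)+\langle W_{x,x},H\rangle+\langle D,X\rangle\\ \text{s.t.}\quad & W_{x,x}\succeq\mathrm{vec}(X^\top)\mathrm{vec}(X^\top)^\top,\\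 & \langle Q_i,W_{x,x}\rangle+\langle E_i,X\rangle\le b_i\quad\forall i\in\mathcal{I},\\ & \begin{pmatrix}\sum_{i\in[n]}W_{x,x}^{(i,i)}&X^\top\\ X&Y\end{pmatrix}\succeq 0,\end{aligned}$$ over $Y\in\mathcal{S}^n_+$ with $Y\preceq I_n$ and $\mathrm{tr}(Y)\le k$, $X\in\mathbb{R}^{n\times m}$, $W_{x,x}\in\mathcal{S}^{nm}_+$.
   Context: $\mathcal{S}^d$ (resp. $\mathcal{S}^d_+$) is the set of $d\times d$ real symmetric (resp. positive semidefinite) matrices; $\langle A,B\rangle=\mathrm{tr}(A^\top B)$; $[n]=\{1,\dots,n\}$; $\mathrm{vec}(\cdot)$ stacks columns, so $\mathrm{vec}(X^\top)\in\mathbb{R}^{nm}$ stacks the rows of $X\in\mathbb{R}^{n\times m}$. The matrices $W_{x,x}\in\mathcal{S}^{nm}$, $W_{x,y}\in\mathbb{R}^{nm\times n^2}$, $W_{y,y}\in\mathcal{S}^{n^2}$ are each partitioned into an $n\times n$ array of equally sized blocks (of sizes $m\times m$, $m\times n$, $n\times n$ respectively), and $W^{(i,j)}$ denotes the $(i,j)$ block. Optimal values are infima in $[-\infty,+\infty]$ ($+\infty$ if infeasible). *)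

(* Defs.v *)
From mathcomp Require Import all_boot all_order all_algebra.
From mathcomp Require Import all_classical all_reals all_analysis.

Set Implicit Arguments.
Unset Strict Implicit.
Unset Printing Implicit Defensive.

Import Order.TTheory GRing.Theory Num.Theory.

Local Open Scope classical_set_scope.
Local Open Scope ring_scope.

Definition psd (R : realType) (n : nat) (A : 'M[R]_n) : Prop :=
  A \is symmetricmx /\ forall u : 'cV[R]_n, 0 <= (u^T *m A *m u) 0 0.

Definition loewner_le (R : realType) (n : nat) (A B : 'M[R]_n) : Prop :=
  psd (B - A).

Definition mxdot (R : realType) (p q : nat) (A B : 'M[R]_(p, q)) : R :=
  \tr (A^T *m B).

(* [mxvec] concatenates rows, so stacking the columns of [A] is [mxvec A^T]. *)
Definition vec (R : realType) (p q : nat) (A : 'M[R]_(p, q)) : 'cV[R]_(q * p) :=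
  (mxvec A^T)^T.

(* The indices [mxvec_index i a], [a : 'I_p], form the [i]-th of [n] consecutive
   segments of length [p] of ['I_(n * p)]; see [val_mxvec_index]. *)
Definition mxblk (R : realType) (n p q : nat) (W : 'M[R]_(n * p, n * q))
    (i j : 'I_n) : 'M[R]_(p, q) :=
  \matrix_(a < p, b < q) W (mxvec_index i a) (mxvec_index j b).

Lemma val_mxvec_index (n p : nat) (i : 'I_n) (a : 'I_p) :
  mxvec_index i a = (i * p + a)%N :> nat.
Proof.
have idx (s : seq 'I_n) (t : seq 'I_p) : i \in s -> a \in t ->
    index (i, a) [seq (x, y) | x <- s, y <- t]
    = (index i s * size t + index a t)%N.
  move=> + ta; elim: s => //= x s IHs; rewrite index_cat.
  have [<- _|xi] := eqVneq i x.
    by rewrite map_f // index_map // => u v [].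
  rewrite inE (negbTE xi) /= => si.
  case: ifPn => [/mapP[y _ [ix _]]|_]; first by rewrite ix eqxx in xi.
  by rewrite size_map IHs // mulSn addnA.
rewrite /mxvec_index /=.
rewrite -[X in X = _ :> nat](@index_uniq _ (i, a) _ (enum {: 'I_n * 'I_p}));
  rewrite ?enum_uniq -?cardE ?ltn_ord // nth_enum_rank.
have -> : enum {: 'I_n * 'I_p} = prod_enum 'I_n 'I_p.
  by rewrite enumT unlock.
by rewrite idx ?mem_enum // !index_enum_ord size_enum_ord.
Qed.

Definition sum_diag_blk (R : realType) (n p q : nat)
    (W : 'M[R]_(n * p, n * q)) : 'M[R]_(p, q) :=
  \sum_(i < n) mxblk W i i.

Definition moment_mx (R : realType) (n m : nat) (Y : 'M[R]_n)
    (Wyy : 'M[R]_(n * n)) (X : 'M[R]_(n, m)) (Wxx : 'M[R]_(n * m))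
    (Wxy : 'M[R]_(n * m, n * n)) : 'M[R]_(1 + (n * m + n * n)) :=
  block_mx 1%:M (row_mx (vec X^T)^T (vec Y)^T)
           (col_mx (vec X^T) (vec Y)) (block_mx Wxx Wxy Wxy^T Wyy).

Definition objective (R : realType) (n m : nat) (lambda : R)
    (H : 'M[R]_(n * m)) (D : 'M[R]_(n, m))
    (Y : 'M[R]_n) (X : 'M[R]_(n, m)) (Wxx : 'M[R]_(n * m)) : R :=
  lambda * \tr Y + mxdot Wxx H + mxdot D X.

Record feasible1 (R : realType) (n m k : nat) (I : Type)
    (Q : I -> 'M[R]_(n * m)) (E : I -> 'M[R]_(n, m)) (b : I -> R)
    (Y : 'M[R]_n) (Wyy : 'M[R]_(n * n)) (X : 'M[R]_(n, m))
    (Wxx : 'M[R]_(n * m)) (Wxy : 'M[R]_(n * m, n * n)) : Prop := Feasible1 {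
  f1_Y_psd : psd Y;
  f1_Y_le1 : loewner_le Y 1%:M;
  f1_Y_tr : \tr Y <= k%:R;
  f1_Wyy_psd : psd Wyy;
  f1_Wxx_psd : psd Wxx;
  f1_moment : psd (moment_mx Y Wyy X Wxx Wxy);
  f1_Wyy_diag : sum_diag_blk Wyy = Y;
  f1_Wxy_diag : sum_diag_blk Wxy = X^T;
  f1_lin : forall i, mxdot (Q i) Wxx + mxdot (E i) X <= b i }.

Record feasible2 (R : realType) (n m k : nat) (I : Type)
    (Q : I -> 'M[R]_(n * m)) (E : I -> 'M[R]_(n, m)) (b : I -> R)
    (Y : 'M[R]_n) (X : 'M[R]_(n, m)) (Wxx : 'M[R]_(n * m)) : Prop := Feasible2 {
  f2_Y_psd : psd Y;
  f2_Y_le1 : loewner_le Y 1%:M;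
  f2_Y_tr : \tr Y <= k%:R;
  f2_Wxx_psd : psd Wxx;
  f2_Wxx_ge : loewner_le (vec X^T *m (vec X^T)^T) Wxx;
  f2_lin : forall i, mxdot (Q i) Wxx + mxdot (E i) X <= b i;
  f2_block : psd (block_mx (sum_diag_blk Wxx) X^T X Y) }.

Definition value1 (R : realType) (n m k : nat) (I : Type) (lambda : R)
    (H : 'M[R]_(n * m)) (D : 'M[R]_(n, m))
    (Q : I -> 'M[R]_(n * m)) (E : I -> 'M[R]_(n, m)) (b : I -> R) : \bar R :=
  ereal_inf [set v | exists Y Wyy X Wxx Wxy,
    feasible1 k Q E b Y Wyy X Wxx Wxy /\ v = (objective lambda H D Y X Wxx)%:E].

Definition value2 (R : realType) (n m k : nat) (I : Type) (lambda : R)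
    (H : 'M[R]_(n * m)) (D : 'M[R]_(n, m))
    (Q : I -> 'M[R]_(n * m)) (E : I -> 'M[R]_(n, m)) (b : I -> R) : \bar R :=
  ereal_inf [set v | exists Y X Wxx,
    feasible2 k Q E b Y X Wxx /\ v = (objective lambda H D Y X Wxx)%:E].

(* Main.v *)
Require Import Defs.
From mathcomp Require Import all_boot all_order all_algebra.
From mathcomp Require Import all_classical all_reals all_analysis.
From mathcomp Require Import ring lra.

(** The two problems have the same feasible triples (Y, X, Wxx), and hence the
    same value: their objectives depend on these three matrices only.

    From the first problem to the second, both constraints to be proved are
    consequences of the moment matrix being psd. The inequality
    Wxx >= vec(X^T) vec(X^T)^T is the Schur complement of its corner 1
    ([moment_mx_cov]). For the other one, the lower right part of the moment
    matrix has, for each i, the principal submatrix formed by the (i,i) blocks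
    of Wxx, Wxy, Wxy^T and Wyy; the sum of these n psd matrices is the block
    matrix of the second problem ([psd_sum_diag_blk]).

    From the second to the first, Wxx is thought of as the second moment of a
    random n x m matrix of mean X and covariance V = Wxx - x x^T, where
    x = vec(X^T). A random n x n matrix of mean Y is produced from it by mapping
    the fluctuation of each row linearly through the same m x n matrix A, and
    adding to the first row an independent noise of covariance N. With J the
    n x n^2 matrix that extracts the first row from a stack of rows, y = vec(Y)
    and L = I_n (x) A, the moments of the pair are
        Wxy = x y^T + V L,   Wyy = y y^T + L^T V L + J^T N J,
    and make the moment matrix psd by construction. Write C for the sum of the
    diagonal blocks of V; it equals S - X^T X, where S is the same sum for Wxx.
    The two conditions on sums of diagonal blocks then read
        C A = X^T (1 - Y),   N = Y - Y^2 - A^T C A.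
    So A must solve a linear system for which N comes out psd. By
    [psd_block_factor] this is possible as soon as the matrix with blocks
    C, X^T (1 - Y), (1 - Y) X, Y - Y^2 is psd, and [psd_cov_block] derives this
    from the constraints of the second problem. *)

Set Implicit Arguments.
Unset Strict Implicit.
Unset Printing Implicit Defensive.

Import Order.TTheory GRing.Theory Num.Theory.

Local Open Scope ring_scope.

(** * Positive semidefinite matrices *)

Section Psd.
Variable R : realType.

Lemma symmetricmx_trmx p (A : 'M[R]_p) : (A \is symmetricmx) = (A^T == A).
Proof. by rewrite is_hermitianmxE expr0 scale1r map_mx_id // eq_sym. Qed.

Lemma psd_trmx p (A : 'M[R]_p) : psd A -> A^T = A.
Proof. by case=> + _; rewrite symmetricmx_trmx => /eqP. Qed.

Lemma psd_congr p q (P : 'M[R]_(q, p)) (A : 'M[R]_p) :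
  psd A -> psd (P *m A *m P^T).
Proof.
move=> Apsd; split=> [|u].
  by rewrite symmetricmx_trmx !trmx_mul trmxK (psd_trmx Apsd) mulmxA.
by have := Apsd.2 (P^T *m u); rewrite trmx_mul trmxK !mulmxA.
Qed.

Lemma psdD p (A B : 'M[R]_p) : psd A -> psd B -> psd (A + B).
Proof.
move=> Apsd Bpsd; split=> [|u].
  by rewrite symmetricmx_trmx linearD /= !psd_trmx.
by rewrite mulmxDr mulmxDl mxE addr_ge0 ?Apsd.2 ?Bpsd.2.
Qed.

Lemma psd1 p : psd (1%:M : 'M[R]_p).
Proof.
split=> [|u]; first by rewrite symmetricmx_trmx trmx1.
by rewrite mulmx1 mxE sumr_ge0 // => i _; rewrite mxE -expr2 sqr_ge0.
Qed.

Lemma psd0 p : psd (0 : 'M[R]_p).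
Proof.
by have := psd_congr (0 : 'M[R]_(p, p)) (psd1 p); rewrite !mul0mx.
Qed.

Lemma psd_sum p (I : Type) (r : seq I) (A : I -> 'M[R]_p) :
  (forall i, psd (A i)) -> psd (\sum_(i <- r) A i).
Proof. by move=> Apsd; elim/big_ind: _ => //; [exact: psd0|exact: psdD]. Qed.

(** Moving from u in the direction -A u changes the form by
    -2 t |A u|^2 + O(t^2), which is negative for small t > 0 unless A u = 0. *)
Lemma psd_isotropic p (A : 'M[R]_p) (u : 'cV[R]_p) :
  psd A -> (u^T *m A *m u) 0 0 = 0 -> A *m u = 0.
Proof.
move=> Apsd Au0; have AT := psd_trmx Apsd.
pose w := A *m u.
pose a : R := (w^T *m w) 0 0; pose c : R := (w^T *m A *m w) 0 0.
have aE : a = \sum_i w i 0 ^+ 2.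
  by rewrite /a mxE; apply: eq_bigr => i _; rewrite mxE expr2.
have c0 : 0 <= c by exact: Apsd.2.
have quad t : 0 <= - (t * a) *+ 2 + t ^+ 2 * c.
  have := Apsd.2 (u - t *: w).
  have -> : (u - t *: w)^T = u^T - t *: w^T by rewrite linearB linearZ.
  rewrite !(mulmxBl, mulmxBr) -!(scalemxAl, scalemxAr).
  rewrite -[u^T *m A *m w]mulmxA.
  have -> : u^T *m (A *m w) = w^T *m w by rewrite mulmxA /w trmx_mul AT.
  rewrite -[w^T *m A *m u]mulmxA -/w.
  have entry00 (M0 M1 M2 : 'M[R]_1) :
      (M0 - t *: M1 - (t *: M1 - t *: (t *: M2))) 0 0
      = M0 0 0 - (t * M1 0 0) *+ 2 + t ^+ 2 * M2 0 0 by rewrite !mxE; ring.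
  by rewrite entry00 Au0 -/a -/c sub0r mulNrn.
have a0 : a = 0.
  have a_ge0 : 0 <= a by rewrite aE sumr_ge0 // => i _; rewrite sqr_ge0.
  apply/eqP; rewrite eq_le a_ge0 andbT leNgt; apply/negP => a_gt0.
  (* The minimiser is t = a / c; adding 1 keeps the denominator nonzero. *)
  have c1 : 0 < c + 1 by lra.
  have := quad (a / (c + 1)).
  have -> : - (a / (c + 1) * a) *+ 2 + (a / (c + 1)) ^+ 2 * c
          = - ((a / (c + 1)) ^+ 2 * (c + 2)) by field; lra.
  rewrite oppr_ge0 leNgt mulr_gt0 ?exprn_gt0 ?divr_gt0 //; lra.
apply/colP => i; rewrite [RHS]mxE; apply/eqP; rewrite -sqrf_eq0 eq_le sqr_ge0.
rewrite andbT -[leRHS]a0 aE (bigD1 i) //= lerDl.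
by rewrite sumr_ge0 // => j _; rewrite sqr_ge0.
Qed.

(** Generalized Schur complement, with A playing the role of C^+ K. A vector of
    the kernel of C, padded with zeros, is isotropic for the whole matrix, so
    K^T kills it too; hence the rows of K^T are combinations of those of C.
    Completing the square then leaves P - A^T C A. *)
Lemma psd_block_factor p q (C : 'M[R]_p) (K : 'M[R]_(p, q)) (P : 'M[R]_q) :
  psd (block_mx C K K^T P) ->
  exists A : 'M[R]_(p, q), C *m A = K /\ psd (P - A^T *m C *m A).
Proof.
move=> Mpsd; have := psd_trmx Mpsd; rewrite tr_block_mx trmxK.
move=> /eq_block_mx[CT _ _ _].
have kerCK (v : 'cV[R]_p) : C *m v = 0 -> K^T *m v = 0.
  move=> Cv0; have := @psd_isotropic _ _ (col_mx v 0) Mpsd.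
  rewrite -mulmxA mul_block_col !mulmx0 !addr0 Cv0 tr_col_mx mul_row_col.
  rewrite mulmx0 trmx0 mul0mx addr0 mxE => /(_ erefl)/eqP.
  by rewrite col_mx_eq0 => /andP[_ /eqP].
have : (K^T <= C)%MS.
  rewrite submxE; apply/eqP/trmx_inj/row_matrixP => j.
  rewrite trmx0 row0 -tr_col colE -mulmxA kerCK ?trmx0 //.
  by rewrite mulmxA mulmx_coker mul0mx.
case/submxP => B KB; exists B^T.
have CB : C *m B^T = K by rewrite -[K]trmxK KB trmx_mul CT.
split=> //; rewrite trmxK.
have := psd_congr (row_mx (- B) 1%:M) Mpsd.
rewrite tr_row_mx trmx1 mul_row_block mul_row_col !mul1mx mulmx1 linearN /=.
by rewrite !mulNmx -KB addNr mul0mx add0r addrC KB -mulmxA CB.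
Qed.

End Psd.

(** * Block matrices and sums of diagonal blocks *)

Section Blocks.
Variable R : realType.

Lemma sum_block_mx (I : Type) (r : seq I) p1 p2 q1 q2
    (A : I -> 'M[R]_(p1, q1)) (B : I -> 'M[R]_(p1, q2))
    (C : I -> 'M[R]_(p2, q1)) (D : I -> 'M[R]_(p2, q2)) :
  \sum_(i <- r) block_mx (A i) (B i) (C i) (D i) =
  block_mx (\sum_(i <- r) A i) (\sum_(i <- r) B i)
           (\sum_(i <- r) C i) (\sum_(i <- r) D i).
Proof.
elim: r => [|i r IH]; last by rewrite !big_cons IH add_block_mx.
by rewrite !big_nil block_mx0.
Qed.

Lemma congr_col_mx p1 p2 q (P1 : 'M[R]_(p1, q)) (P2 : 'M[R]_(p2, q)) A :
  col_mx P1 P2 *m A *m (col_mx P1 P2)^T =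
  block_mx (P1 *m A *m P1^T) (P1 *m A *m P2^T)
           (P2 *m A *m P1^T) (P2 *m A *m P2^T).
Proof. by rewrite tr_col_mx mul_col_mx mul_col_row. Qed.

(** The p x (n p) matrix that extracts the i-th of n segments of length p: it
    turns blocks, sums of diagonal blocks and Kronecker products into matrix
    products governed by [seg_orth]. *)
Definition seg n p (i : 'I_n) : 'M[R]_(p, n * p) :=
  rowsub (mxvec_index i) 1%:M.

Lemma mxblk_seg n p q (W : 'M[R]_(n * p, n * q)) (i j : 'I_n) :
  mxblk W i j = seg p i *m W *m (seg q j)^T.
Proof.
rewrite /seg -rowsubE trmx_mxsub trmx1 mulmx_colsub mulmx1.
by apply/matrixP => a b; rewrite !mxE.
Qed.

Lemma seg_orth n p (i j : 'I_n) :
  seg p i *m (seg p j)^T = if i == j then 1%:M else 0.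
Proof.
have -> : seg p i *m (seg p j)^T = mxblk 1%:M i j by rewrite mxblk_seg mulmx1.
apply/matrixP => a b; rewrite !mxE (inj_eq (@cast_ord_inj _ _ _)).
rewrite (inj_eq enum_rank_inj) xpair_eqE.
by case: (i == j); rewrite !mxE.
Qed.

Lemma sum_diag_blkE n p q (W : 'M[R]_(n * p, n * q)) :
  sum_diag_blk W = \sum_i seg p i *m W *m (seg q i)^T.
Proof. by apply: eq_bigr => i _; rewrite mxblk_seg. Qed.

Lemma sum_diag_blkD n p q (V W : 'M[R]_(n * p, n * q)) :
  sum_diag_blk (V + W) = sum_diag_blk V + sum_diag_blk W.
Proof.
rewrite !sum_diag_blkE -big_split; apply: eq_bigr => i _ /=.
by rewrite mulmxDr mulmxDl.
Qed.

Lemma sum_diag_blk_trmx n p q (W : 'M[R]_(n * p, n * q)) :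
  sum_diag_blk W^T = (sum_diag_blk W)^T.
Proof.
rewrite !sum_diag_blkE linear_sum; apply: eq_bigr => i _ /=.
by rewrite !trmx_mul trmxK mulmxA.
Qed.

(** The i-th segment of vec(X^T) is the i-th row of X, so this is X^T Y written
    as a sum of outer products of rows. *)
Lemma sum_diag_blk_outer n p q (X : 'M[R]_(n, p)) (Y : 'M[R]_(n, q)) :
  sum_diag_blk (vec X^T *m (vec Y^T)^T) = X^T *m Y.
Proof.
apply/matrixP => a b; rewrite !mxE summxE; apply: eq_bigr => i _.
by rewrite !mxE big_ord1 /vec !trmxK !mxE !mxvecE.
Qed.

Lemma sum_diag_blk_seg n p (i : 'I_n) (N : 'M[R]_p) :
  sum_diag_blk ((seg p i)^T *m N *m seg p i) = N.
Proof.
rewrite sum_diag_blkE (bigD1 i) //= big1 => [|j /negbTE ji].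
  by rewrite !mulmxA seg_orth eqxx mul1mx -mulmxA seg_orth eqxx mulmx1 addr0.
by rewrite !mulmxA seg_orth ji !mul0mx.
Qed.

(** The Kronecker product of the identity of size n with A. *)
Definition diag_blk n p q (A : 'M[R]_(p, q)) : 'M[R]_(n * p, n * q) :=
  \sum_i (seg p i)^T *m A *m seg q i.

Lemma mul_diag_blk_seg n p q (A : 'M[R]_(p, q)) (i : 'I_n) :
  diag_blk n A *m (seg q i)^T = (seg p i)^T *m A.
Proof.
rewrite /diag_blk mulmx_suml (bigD1 i) //= big1 => [|j /negbTE ji].
  by rewrite -mulmxA seg_orth eqxx mulmx1 addr0.
by rewrite -mulmxA seg_orth ji mulmx0.
Qed.

Lemma sum_diag_blkM n p q r (W : 'M[R]_(n * r, n * p)) (A : 'M[R]_(p, q)) :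
  sum_diag_blk (W *m diag_blk n A) = sum_diag_blk W *m A.
Proof.
rewrite !sum_diag_blkE mulmx_suml; apply: eq_bigr => i _.
by rewrite -!mulmxA mul_diag_blk_seg.
Qed.

(** The right-hand side is the sum over i of the compressions of the given matrix
    to the i-th segments of its two index ranges. *)
Lemma psd_sum_diag_blk n p q (A : 'M[R]_(n * p)) (B : 'M[R]_(n * p, n * q))
    (D : 'M[R]_(n * q)) :
  psd (block_mx A B B^T D) ->
  psd (block_mx (sum_diag_blk A) (sum_diag_blk B) (sum_diag_blk B)^T
                (sum_diag_blk D)).
Proof.
move=> Mpsd; rewrite -sum_diag_blk_trmx !sum_diag_blkE -sum_block_mx.
apply: psd_sum => i.
have := psd_congr (block_mx (seg p i) 0 0 (seg q i)) Mpsd.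
by rewrite tr_block_mx !trmx0 !mulmx_block !(mul0mx, mulmx0, addr0, add0r).
Qed.

End Blocks.

(** * Comparison of the feasible sets *)

Section Moment.
Variable R : realType.

Lemma psd_moment_mx n m (Y : 'M[R]_n) Wyy (X : 'M[R]_(n, m)) Wxx Wxy :
  psd (moment_mx Y Wyy X Wxx Wxy) ->
  psd (block_mx Wxx Wxy Wxy^T Wyy).
Proof.
move=> /(psd_congr (row_mx 0 1%:M)).
by rewrite tr_row_mx trmx0 trmx1 mul_row_block mul_row_col
  !(mul0mx, mul1mx, mulmx0, mulmx1, add0r).
Qed.

(** The vectors (- u^T x, u, 0), with x = vec(X^T), turn the quadratic form of the
    moment matrix into that of Wxx - x x^T. *)
Lemma moment_mx_cov n m (Y : 'M[R]_n) Wyy (X : 'M[R]_(n, m)) Wxx Wxy :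
  psd (moment_mx Y Wyy X Wxx Wxy) ->
  loewner_le (vec X^T *m (vec X^T)^T) Wxx.
Proof.
move=> /(psd_congr (row_mx (- vec X^T) (row_mx 1%:M 0))).
rewrite /moment_mx !tr_row_mx trmx0 trmx1 linearN /= mul_row_block mul_row_col.
rewrite mul_mx_row mul_row_block mul_row_col add_row_mx mul_row_col.
rewrite !(mul0mx, mul1mx, mulmx0, mulmx1, add0r, addr0, mulNmx).
by rewrite addNr mul0mx add0r addrC.
Qed.

Lemma feasible1_feasible2 n m k (I : Type) Q E (b : I -> R)
    (Y : 'M[R]_n) Wyy (X : 'M[R]_(n, m)) Wxx Wxy :
  feasible1 k Q E b Y Wyy X Wxx Wxy -> feasible2 k Q E b Y X Wxx.
Proof.
case=> Ypsd Y1 Ytr _ Wxx_psd Mpsd Wyy_diag Wxy_diag lin; split=> //.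
  exact: moment_mx_cov Mpsd.
have := psd_sum_diag_blk (psd_moment_mx Mpsd).
by rewrite Wyy_diag Wxy_diag trmxK.
Qed.

(** Write Z = 1 - Y. The form of the conclusion at (v, w) exceeds the form of the
    hypothesis at (v, - X v + Z w) by the form of Z at X v + Y w. The choice of
    - X v + Z w is forced: with t in place of Z w, the excess is a quadratic
    function of p = X v whose minimum over all vectors p is - |Z w - t|^2. *)
Lemma psd_cov_block n m (S : 'M[R]_m) (X : 'M[R]_(n, m)) (Y : 'M[R]_n) :
  psd (1%:M - Y) -> psd (block_mx S X^T X Y) ->
  psd (block_mx (S - X^T *m X) (X^T *m (1%:M - Y))
                (X^T *m (1%:M - Y))^T (Y - Y *m Y)).
Proof.
move=> Zpsd Fpsd; set Z := 1%:M - Y.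
have := psd_trmx Fpsd; rewrite tr_block_mx => /eq_block_mx[_ _ _ YT].
have ZT : Z^T = Z := psd_trmx Zpsd.
have ZY : Z + Y = 1%:M by rewrite subrK.
have comm : Z *m Y = Y *m Z by rewrite mulmxBl mulmxBr mul1mx mulmx1.
have YZ : Y - Y *m Y = Y *m Z by rewrite mulmxBr mulmx1.
have XZ : X^T - X^T *m Y = X^T *m Z by rewrite mulmxBr mulmx1.
have := psdD (psd_congr (block_mx 1%:M (- X^T) 0 Z) Fpsd)
             (psd_congr (col_mx X^T Y) Zpsd).
rewrite tr_block_mx tr_col_mx linearN /= trmxK trmx1 trmx0 ZT YT.
rewrite !mulmx_block mul_col_mx mul_col_row add_block_mx.
rewrite !(mul0mx, mul1mx, mulmx0, mulmx1, add0r, addr0) !mulNmx XZ.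
rewrite trmx_mul trmxK ZT YZ -/Z.
congr psd; congr block_mx.
- by rewrite mulmxN subrK.
- by rewrite -!mulmxA -mulmxDr comm -mulmxDl ZY mul1mx.
- by rewrite mulmxN -comm subrK.
- by rewrite comm -!mulmxA -!mulmxDr ZY mulmx1.
Qed.

Lemma feasible2_feasible1 n m k (hn : (0 < n)%N) (I : Type) Q E (b : I -> R)
    (Y : 'M[R]_n) (X : 'M[R]_(n, m)) Wxx :
  feasible2 k Q E b Y X Wxx ->
  exists Wyy Wxy, feasible1 k Q E b Y Wyy X Wxx Wxy.
Proof.
case=> Ypsd Zpsd Ytr Wxx_psd Vpsd0 lin Fpsd.
have YT := psd_trmx Ypsd; pose x := vec X^T.
have [V [Vpsd WxxE]] : exists V, psd V /\ Wxx = x *m x^T + V.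
  by exists (Wxx - x *m x^T); split; [exact: Vpsd0|rewrite addrC subrK].
have VT := psd_trmx Vpsd.
have VC : sum_diag_blk V = sum_diag_blk Wxx - X^T *m X.
  by rewrite WxxE sum_diag_blkD /x sum_diag_blk_outer addrAC subrr add0r.
have [A [CA Npsd]] := psd_block_factor (psd_cov_block Zpsd Fpsd).
set N := (_ - _ - _) in Npsd; rewrite -VC in CA N Npsd.
pose i0 := Ordinal hn; pose L := diag_blk n A; pose y := vec Y.
have yE : y = vec Y^T by rewrite YT.
pose J := seg R n i0.
pose Wxy := x *m y^T + V *m L.
pose Wyy := y *m y^T + (L^T *m V *m L + J^T *m N *m J).
(* Three independent contributions: the means, the fluctuation of covariance V
   seen through (1, L^T), and the noise. *)
have Mpsd : psd (moment_mx Y Wyy X Wxx Wxy).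
  have := psdD (psd_congr (col_mx 1%:M (col_mx x y)) (psd1 R 1))
    (psdD (psd_congr (col_mx 0 (col_mx 1%:M L^T)) Vpsd)
          (psd_congr (col_mx 0 (col_mx 0 J^T)) Npsd)).
  congr psd; rewrite !congr_col_mx !trmx0 !trmx1 [L^T^T]trmxK [J^T^T]trmxK.
  rewrite !(mul0mx, mulmx0, mul1mx, mulmx1) !add_block_mx !addr0.
  rewrite tr_col_mx -WxxE; congr block_mx; congr block_mx.
  by rewrite linearD /= !trmx_mul [y^T^T]trmxK VT.
exists Wyy, Wxy; split=> //.
- have := psd_congr (row_mx 0 1%:M) (psd_moment_mx Mpsd).
  by rewrite tr_row_mx trmx0 trmx1 mul_row_block mul_row_col
    !(mul0mx, mul1mx, mulmx0, mulmx1, add0r).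
- rewrite /Wyy !sum_diag_blkD sum_diag_blk_seg sum_diag_blkM.
  rewrite -[L^T *m V]trmxK trmx_mul [L^T^T]trmxK VT.
  rewrite sum_diag_blk_trmx sum_diag_blkM.
  rewrite {1 2}yE sum_diag_blk_outer YT trmx_mul -sum_diag_blk_trmx VT.
  by rewrite addrA /N addrACA subrr addr0 [LHS]addrC subrK.
- by rewrite /Wxy sum_diag_blkD sum_diag_blkM CA yE /x sum_diag_blk_outer
    -mulmxDr [Y + _]addrC subrK mulmx1.
Qed.

End Moment.

Theorem theorem1 (R : realType) (n m k : nat)
    (hn : (0 < n)%N) (hm : (0 < m)%N) (hk : (0 < k)%N)
    (lambda : R) (hlambda : 0 <= lambda)
    (H : 'M[R]_(n * m)) (hH : H \is symmetricmx) (D : 'M[R]_(n, m))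
    (I : Type) (Q : I -> 'M[R]_(n * m)) (hQ : forall i, Q i \is symmetricmx)
    (E : I -> 'M[R]_(n, m)) (b : I -> R) :
  value1 k lambda H D Q E b = value2 k lambda H D Q E b.
Proof.
congr ereal_inf; apply/seteqP; split=> v /=.
  by case=> Y [Wyy [X [Wxx [Wxy [/feasible1_feasible2 F vE]]]]]; exists Y, X, Wxx.
case=> Y [X [Wxx [/(feasible2_feasible1 hn)[Wyy [Wxy F]] vE]]].
by exists Y, Wyy, X, Wxx, Wxy.
Qed.
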